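(* Let $\Lambda$ be a unimodular lattice of dimension $n$, and let $a_0,\dots,a_{\lfloor n/8\rfloor}\in\mathbb{Z}$ be the coefficients in the decomposition $$\Theta_{\Lambda}(\tau)=\sum_{r=0}^{\lfloor n/8\rfloor}a_r\,\vartheta_3^{\,n-8r}(\tau)\,\Delta_8^{\,r}(\tau).$$ Assume that the secrecy function of $\Lambda$ attains its maximum at $\tau=i$. Then the secrecy gain of $\Lambda$ is $$\chi_{\Lambda}=\frac{1}{\sum_{r=0}^{\lfloor n/8\rfloor}a_r\left(\frac{1}{2^6}\right)^r}.$$
   Context: A lattice $\Lambda\subset\mathbb{R}^n$ of dimension $n$ is the set of integer combinations of a basis of $\mathbb{R}^n$; it is unimodular if it equals its dual $\Lambda^*=\{\mathbf{x}\in\mathbb{R}^n:\mathbf{x}\cdot\lambda\in\mathbb{Z}\ \text{for all } \lambda\in\Lambda\}$. For $\tau$ in the upper half plane $\mathcal{H}$ let $q=e^{\pi i\tau}$. The Jacobi theta functions are $\vartheta_2(\tau)=\sum_{m\in\mathbb{Z}}q^{(m+1/2)^2}$, $\vartheta_3(\tau)=\sum_{m\in\mathbb{Z}}q^{m^2}$, $\vartheta_4(\tau)=\sum_{m\in\mathbb{Z}}(-q)^{m^2}$, and $\Delta_8(\tau)=\frac{1}{16}\vartheta_2^4(\tau)\vartheta_4^4(\tau)$. The theta series of $\Lambda$ is $\Theta_\Lambda(\tau)=\sum_{\lambda\in\Lambda}q^{\lambda\cdot\lambda}$. By a known theorem of Hecke, the theta series of every unimodular lattice has a decomposition of the form displayed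 in the claim, with integer coefficients. The secrecy function of an $n$-dimensional lattice $\Lambda$ of volume $v^n$ is $\Xi_\Lambda(\tau)=\Theta_{v\mathbb{Z}^n}(\tau)/\Theta_\Lambda(\tau)$, considered for $\tau=yi$ with $y>0$; for a unimodular lattice $v=1$, so $\Xi_\Lambda(\tau)=\vartheta_3^n(\tau)/\Theta_\Lambda(\tau)$. The secrecy gain $\chi_\Lambda$ is the maximal value of $\Xi_\Lambda(yi)$ over $y>0$. *)

(* Defs.v *)
From HB Require Import structures.
From mathcomp Require Import all_boot all_order all_algebra finmap complex.
From mathcomp Require Import all_classical all_reals all_analysis.
From mathcomp Require Import summability.

Set Implicit Arguments.
Unset Strict Implicit.
Unset Printing Implicit Defensive.

Import Order.TTheory GRing.Theory Num.Theory.
Import numFieldNormedType.Exports.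

Local Open Scope classical_set_scope.
Local Open Scope ring_scope.
Local Open Scope complex_scope.

(* Unordered sum of a complex family: [summability.sum] is the limit of the
   partial sums along the directed set of finite subsets of the index type, and
   [R[i]^o] is [R[i]] with the topology of its norm.  For t in the upper half
   plane and L a lattice, all the families summed below converge absolutely. *)
Definition csum (R : realType) (I : choiceType) (f : I -> R[i]) : R[i] :=
  summability.sum (f : I -> R[i]^o).

Definition cexp (R : realType) (z : R[i]) : R[i] :=
  (expR (complex.Re z))%:C * (cos (complex.Im z) +i* sin (complex.Im z)).

Definition upper_half_plane (R : realType) : set R[i] :=
  [set t | 0 < complex.Im t].

(* q^x for q = e^(pi i t) and x real, with the usual branch e^(pi i t x). *)
Definition qpow (R : realType) (t : R[i]) (x : R) : R[i] :=
  cexp (pi%:C * 'i * t * x%:C).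

Definition theta2 (R : realType) (t : R[i]) : R[i] :=
  csum (fun m : int => qpow t ((m%:~R + 1 / 2) ^+ 2)).

Definition theta3 (R : realType) (t : R[i]) : R[i] :=
  csum (fun m : int => qpow t (m%:~R ^+ 2)).

Definition theta4 (R : realType) (t : R[i]) : R[i] :=
  csum (fun m : int => (- qpow t 1) ^+ (`|m| ^ 2)%N).

Definition Delta8 (R : realType) (t : R[i]) : R[i] :=
  1 / 16 * theta2 t ^+ 4 * theta4 t ^+ 4.

Definition dotprod (R : realType) (n : nat) (x y : 'rV[R]_n) : R :=
  \sum_(i < n) x 0 i * y 0 i.

(* The integer combinations of the rows of B. *)
Definition lattice_of (R : realType) (n : nat) (B : 'M[R]_n) : set 'rV[R]_n :=
  [set map_mx intr z *m B | z in [set: 'rV[int]_n]].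

Definition is_basis_of (R : realType) (n : nat) (L : set 'rV[R]_n)
    (B : 'M[R]_n) : Prop :=
  B \in unitmx /\ L = lattice_of B.

Definition is_lattice (R : realType) (n : nat) (L : set 'rV[R]_n) : Prop :=
  exists B : 'M[R]_n, is_basis_of L B.

Definition dual_lattice (R : realType) (n : nat) (L : set 'rV[R]_n) :
    set 'rV[R]_n :=
  [set x | forall l, L l -> dotprod x l \is a Num.int].

Definition unimodular (R : realType) (n : nat) (L : set 'rV[R]_n) : Prop :=
  is_lattice L /\ L = dual_lattice L.

(* |det B| for a basis B chosen among those of L; for a lattice, the value does
   not depend on the choice. *)
Definition lattice_volume (R : realType) (n : nat) (L : set 'rV[R]_n) : R :=
  `|\det (xget 0 [set B | is_basis_of L B])|.

Definition theta_series (R : realType) (n : nat) (L : set 'rV[R]_n)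
    (t : R[i]) : R[i] :=
  csum (fun l : L => qpow t (dotprod (val l) (val l))).

(* [lattice_of v%:M] is vZ^n, with v^n the volume of L. *)
Definition secrecy_function (R : realType) (n : nat) (L : set 'rV[R]_n)
    (t : R[i]) : R[i] :=
  let v := lattice_volume L `^ n%:R^-1 in
  theta_series (lattice_of (v%:M : 'M[R]_n)) t / theta_series L t.

(* In the order of [R[i]], [z <= w] means that w - z is a nonnegative real; the
   secrecy function takes real values on the positive imaginary axis. *)
Definition secrecy_max_at (R : realType) (n : nat) (L : set 'rV[R]_n)
    (y0 : R) : Prop :=
  0 < y0 /\ forall y : R, 0 < y ->
    secrecy_function L (0 +i* y) <= secrecy_function L (0 +i* y0).

Definition is_secrecy_gain (R : realType) (n : nat) (L : set 'rV[R]_n)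
    (chi : R) : Prop :=
  exists y0 : R, secrecy_max_at L y0 /\
    chi%:C = secrecy_function L (0 +i* y0).

(* Main.v *)
Require Import Defs.
From HB Require Import structures.
From mathcomp Require Import all_boot all_order all_algebra finmap complex.
From mathcomp Require Import all_classical all_reals all_analysis.
From mathcomp Require Import measurable_realfun summability ring lra zify.

(* At t = i the claim amounts to Delta8(i) = theta3(i)^8 / 2^6, i.e. to
   theta2(i)^4 = theta4(i)^4 = theta3(i)^4 / 2.  Instead of Poisson summation,
   the proof uses the arithmetic-geometric mean M.  The duplication formulas
   for s -> 2s say that (theta3^2, theta4^2)(i 2^n) are AGM iterates, so
   M(theta3(i)^2, theta4(i)^2) = lim theta3(i 2^n)^2 = 1.  Read backwards, they
   say that 2^-n (theta3^2, theta2^2)(i 2^-n) are AGM iterates as well, so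
   M(theta3(i)^2, theta2(i)^2) = lim 2^-n theta3(i 2^-n)^2, which is again 1
   since sqrt(s) theta3(is) is a Riemann sum for the Gauss integral.  As M is
   strictly increasing in each argument, theta2(i)^2 = theta4(i)^2; the Jacobi
   identity theta3^4 = theta2^4 + theta4^4 also follows from duplication. *)

Set Implicit Arguments.
Unset Strict Implicit.
Unset Printing Implicit Defensive.

Import Order.TTheory GRing.Theory Num.Theory.
Import numFieldNormedType.Exports.

Local Open Scope classical_set_scope.
Local Open Scope ring_scope.
Local Open Scope complex_scope.

#[local] Existing Instance totally_filter.

(** * Unordered sums *)

(** Partial sums of a nonnegative family grow with the finite set, so one finite set within epsilon
    of the supremum controls all its supersets. This links complex unordered sums to [esum]. *)
Lemma partial_sum_cvg_esum (R : realType) (I : choiceType) (f : I -> R) :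
    (forall i, 0 <= f i) -> (\esum_(i in [set: I]) (f i)%:E < +oo)%E ->
  partial_sum (fun i => (f i)%:C : R[i]^o) @ totally -->
    ((fine (\esum_(i in [set: I]) (f i)%:E))%:C : R[i]^o).
Proof.
move=> f0 foo; set s := fine _.
have fin : \esum_(i in [set: I]) (f i)%:E \is a fin_num.
  by rewrite ge0_fin_numE// esum_ge0// => i _; rewrite lee_fin.
have psE (A : {fset I}) : partial_sum (fun i => (f i)%:C : R[i]^o) A =
    (\sum_(i <- A) f i)%:C.
  by rewrite /partial_sum big_seq_fsetE/= rmorph_sum.
have fsE (A : {fset I}) : (\sum_(i \in [set` A]) (f i)%:E)%E =
    (\sum_(i <- A) f i)%:E.
  by rewrite fsbig_finite//= set_fsetK sumEFin.
have le_s (A : {fset I}) : \sum_(i <- A) f i <= s.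
  rewrite -lee_fin /s fineK// -fsE; apply: ereal_sup_ubound.
  by exists [set` A] => //; split.
(* The radius lies in [R[i]]; being positive there, it is a positive real, so only its real part
   matters. *)
apply/cvgrPdist_lt => e; rewrite ltcE/= => /andP[/eqP e'0 e0].
have : ((s - complex.Re e)%:E < \esum_(i in [set: I]) (f i)%:E)%E.
  by rewrite -(fineK fin) lte_fin ltrBlDr ltrDl.
move=> /ereal_sup_gt[_ [X [finX _] <-]].
rewrite fsbig_finite//= sumEFin lte_fin => sX.
exists (fset_set X) => // B /= XB.
rewrite psE -rmorphB/=.
have [d0 dlt] : 0 <= s - \sum_(i <- B) f i /\ s - \sum_(i <- B) f i < complex.Re e.
  split; first by rewrite subr_ge0.
  rewrite ltrBlDl -ltrBlDr (lt_le_trans sX)//.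
  have /= := @lee_fsum_nneg_subset _ _ [set` fset_set X] [set` B]
    (fun i => (f i)%:E); rewrite !fsE lee_fin; apply => //.
    by move=> x; rewrite !inE; exact: (fsubsetP XB).
  by move=> t _; rewrite lee_fin.
rewrite normc_def/= expr0n/= addr0 sqrtr_sqr ger0_norm// ltcE/= dlt andbT.
by rewrite e'0.
Qed.

Lemma csum_lim (R : realType) (I : choiceType) (f : I -> R[i]) (l : R[i]) :
  partial_sum (f : I -> R[i]^o) @ totally --> (l : R[i]^o) -> csum f = l.
Proof. exact: (@cvg_lim R[i]^o (@norm_hausdorff _ _)). Qed.

Lemma csum_esum (R : realType) (I : choiceType) (f : I -> R) :
    (forall i, 0 <= f i) -> (\esum_(i in [set: I]) (f i)%:E < +oo)%E ->
  csum (fun i => (f i)%:C) = (fine (\esum_(i in [set: I]) (f i)%:E))%:C.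
Proof. by move=> f0 foo; exact/csum_lim/partial_sum_cvg_esum. Qed.

(** Meant for the signed series of theta4, split into its positive and negative terms. *)
Lemma csumB_esum (R : realType) (I : choiceType) (f g : I -> R) :
    (forall i, 0 <= f i) -> (\esum_(i in [set: I]) (f i)%:E < +oo)%E ->
    (forall i, 0 <= g i) -> (\esum_(i in [set: I]) (g i)%:E < +oo)%E ->
  csum (fun i => (f i - g i)%:C) = (fine (\esum_(i in [set: I]) (f i)%:E) -
    fine (\esum_(i in [set: I]) (g i)%:E))%:C.
Proof.
move=> f0 foo g0 goo; apply: csum_lim; rewrite rmorphB.
suff -> : partial_sum (fun i => (f i - g i)%:C : R[i]^o) =
    partial_sum (fun i => (f i)%:C : R[i]^o) -
    partial_sum (fun i => (g i)%:C : R[i]^o).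
  exact: cvgB (partial_sum_cvg_esum f0 foo) (partial_sum_cvg_esum g0 goo).
apply/funext => A /=; rewrite /partial_sum fctE -sumrB.
by apply: eq_bigr => i _; rewrite rmorphB.
Qed.

(** * Riemann sums and bounds on theta3 *)

Section riemann_sums.
Context {R : realType}.
Let mu := @lebesgue_measure R.
Variables (g : R -> R) (h : R).
Hypotheses (h0 : 0 < h) (g0 : forall x, 0 <= g x) (mg : measurable_fun setT g).
Hypothesis g_dec : forall x y, 0 <= x -> x <= y -> g y <= g x.

Let cell (k : nat) : set R := `[k%:R * h, k.+1%:R * h[%classic.

Let integral_cells : (\int[mu]_(x in `[0%R, +oo[) (g x)%:E =
  \sum_(k <oo) \int[mu]_(x in cell k) (g x)%:E)%E.
Proof.
have -> : `[0, +oo[%classic = \bigcup_k cell k.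
  apply/seteqP; split => [x|x [k _]]; rewrite /cell/= !in_itv/= ?andbT => x0.
    exists (Num.truncn (x / h)) => //=; rewrite in_itv/=.
    by rewrite -ler_pdivlMr// -ltr_pdivrMr// truncn_itv// divr_ge0// ltW.
  by case/andP: x0 => + _; apply: le_trans; rewrite mulr_ge0// ltW.
rewrite ge0_integral_bigcup//=.
- by move=> k; exact: measurable_itv.
- by apply/measurable_EFinP; exact: measurable_funTS.
- by move=> x _; rewrite lee_fin.
- apply: ltn_trivIset => m n mn; apply/seteqP; split=> // x [].
  rewrite /cell/= !in_itv/= => /andP[_ +] /andP[mx _]; rewrite ltNge => /negP; apply.
  by apply: le_trans mx; rewrite ler_pM2r// ler_nat.
Qed.

Let mu_cell k : mu (cell k) = h%:E.
Proof.
rewrite /mu lebesgue_measure_itv/= lte_fin ltr_pM2r// ltr_nat ltnSn.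
by rewrite -EFinB -mulrBl -natrB// subSnn mul1r.
Qed.

Let integral_cst_cell (c : R) k : (\int[mu]_(x in cell k) c%:E = h%:E * c%:E)%E.
Proof.
rewrite integral_cst/=; last exact: measurable_itv.
by rewrite muleC -/mu mu_cell.
Qed.

(** On each cell a decreasing g stays above its value at the right end, whence the index [k.+1]. *)
Lemma lower_riemann_sum_le_integral :
  (h%:E * \sum_(k <oo) (g (k.+1%:R * h))%:E <=
   \int[mu]_(x in `[0%R, +oo[) (g x)%:E)%E.
Proof.
rewrite integral_cells -nneseriesZl; last by move=> i _; rewrite lee_fin.
apply: lee_nneseries => [k _ _|k _]; first by rewrite mule_ge0 ?lee_fin// ltW.
rewrite -(integral_cst_cell _ k); apply: ge0_le_integral => //=.
- exact: measurable_itv.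
- by move=> x _; rewrite lee_fin.
- by apply/measurable_EFinP; exact: measurable_funTS.
- move=> x; rewrite /cell/= in_itv/= => /andP[kx xk]; rewrite lee_fin g_dec//.
    by apply: le_trans kx; rewrite mulr_ge0// ltW.
  exact: ltW.
Qed.

Lemma integral_le_upper_riemann_sum :
  (\int[mu]_(x in `[0%R, +oo[) (g x)%:E <=
   h%:E * \sum_(k <oo) (g (k%:R * h))%:E)%E.
Proof.
rewrite integral_cells -nneseriesZl; last by move=> i _; rewrite lee_fin.
apply: lee_nneseries => [k _ _|k _].
  by apply: integral_ge0 => x _; rewrite lee_fin.
rewrite -(integral_cst_cell _ k); apply: ge0_le_integral => //=.
- exact: measurable_itv.
- by move=> x _; rewrite lee_fin.
- by apply/measurable_EFinP; exact: measurable_funTS.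
- move=> x; rewrite /cell/= in_itv/= => /andP[kx xk]; rewrite lee_fin g_dec//.
  by rewrite mulr_ge0// ltW.
Qed.

End riemann_sums.

(** Serves to split [int] by sign or by parity, and [int * int] by the parity of the coordinate
    sum. *)
Lemma esum_cover2 {R : realType} {I J : choiceType} (e0 e1 : J -> I)
    (f : I -> \bar R) : (forall i, 0 <= f i)%E ->
    injective e0 -> injective e1 -> (forall j k, e0 j <> e1 k) ->
    (forall i, (exists j, e0 j = i) \/ (exists j, e1 j = i)) ->
  (\esum_(i in [set: I]) f i =
   \esum_(j in [set: J]) f (e0 j) + \esum_(j in [set: J]) f (e1 j))%E.
Proof.
move=> f0 inj0 inj1 dis cov; rewrite (esumID (range e0))// !setTI.
congr (_ + _)%E; apply: reindex_esum; split => /=.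
- by move=> k /= _; exists k.
- by move=> k l _ _ /inj0.
- by move=> m [k _ <-]; exists k.
- by move=> k /= _ [l _ /dis].
- by move=> k l _ _ /inj1.
- by move=> m /= mN; have [[j jm]|[j jm]] := cov m; [case: mN|]; exists j.
Qed.

Lemma esum_int {R : realType} (f : int -> \bar R) : (forall m, 0 <= f m)%E ->
  (\esum_(m in [set: int]) f m =
   \sum_(k <oo) f (Posz k) + \sum_(k <oo) f (Negz k))%E.
Proof.
move=> f0; rewrite !nneseries_esumT//; apply: esum_cover2 => //.
- by move=> k l [].
- by move=> k l [].
- by move=> m; case: m => k; [left|right]; exists k.
Qed.

Definition gaussian {R : realType} (s x : R) : R := expR (- (pi * s * x ^+ 2)).

(** This is theta3(is) for c = 0 and theta2(is) for c = 1/2. In the extended reals, rearranging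
    needs only nonnegativity of the terms. *)
Definition theta_sum {R : realType} (c s : R) : \bar R :=
  \esum_(m in [set: int]) (gaussian s (m%:~R + c))%:E.

Lemma gaussian_ge0 {R : realType} (s x : R) : 0 <= gaussian s x.
Proof. exact: expR_ge0. Qed.

Lemma gaussian_scale {R : realType} (s x : R) : 0 <= s ->
  gaussian s x = gauss_fun (x * Num.sqrt (pi * s)).
Proof.
move=> s0; rewrite /gaussian /gauss_fun exprMn sqr_sqrtr ?mulr_ge0 ?pi_ge0//.
by rewrite mulrC.
Qed.

Lemma theta_sum_ge0 {R : realType} (c s : R) : (0 <= theta_sum c s)%E.
Proof. by apply: esum_ge0 => m _; rewrite lee_fin gaussian_ge0. Qed.

Section theta3_bounds.
Context {R : realType}.
Variable s : R.
Hypothesis s0 : 0 < s.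
(** With this mesh, [gauss_fun (k%:R * h)] is the k-th term of theta3(is), and V collects the terms
    with k >= 1. *)
Let h := Num.sqrt (pi * s).
Let V := (\sum_(k <oo) (gauss_fun (k.+1%:R * h))%:E)%E.

Let h0 : 0 < h. Proof. by rewrite sqrtr_gt0 mulr_gt0// pi_gt0. Qed.

Let V0 : (0 <= V)%E.
Proof. by apply: nneseries_ge0 => k _ _; rewrite lee_fin gauss_fun_ge0. Qed.

Let gauss_fun_dec (x y : R) : 0 <= x -> x <= y -> gauss_fun y <= gauss_fun x.
Proof.
by move=> x0 xy; rewrite ler_expR lerN2 lerXn2r// nnegrE// (le_trans x0).
Qed.

Let upper_sum : (\sum_(k <oo) (gauss_fun (k%:R * h))%:E = 1 + V)%E.
Proof.
rewrite nneseries_recl//; last by move=> k _; rewrite lee_fin gauss_fun_ge0.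
rewrite mul0r {1}/gauss_fun expr0n oppr0 expR0; congr (_ + _)%E.
rewrite -nneseries_addn; last by move=> k; rewrite lee_fin gauss_fun_ge0.
by apply: eq_eseriesr => k _; rewrite addn1.
Qed.

Let theta_sumE : (theta_sum 0 s = 1 + V + V)%E.
Proof.
rewrite /theta_sum esum_int; last by move=> m; rewrite lee_fin gaussian_ge0.
rewrite -upper_sum; congr (_ + _)%E; apply: eq_eseriesr => k _.
  by rewrite addr0 gaussian_scale// ltW.
by rewrite addr0 gaussian_scale ?ltW// NegzE mulrNz mulNr /gauss_fun sqrrN.
Qed.

Let lower : (h%:E * V <= (Num.sqrt pi / 2)%:E)%E.
Proof.
rewrite -integral0y_gauss; apply: lower_riemann_sum_le_integral => //.
  exact: gauss_fun_ge0.
exact: measurable_gauss_fun.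
Qed.

Let upper : ((Num.sqrt pi / 2)%:E <= h%:E * (1 + V))%E.
Proof.
rewrite -integral0y_gauss -upper_sum; apply: integral_le_upper_riemann_sum => //.
  exact: gauss_fun_ge0.
exact: measurable_gauss_fun.
Qed.

Lemma theta_sum0_fin : (theta_sum 0 s < +oo)%E.
Proof.
rewrite theta_sumE; have : (V < +oo)%E.
  rewrite ltNge leye_eq; apply/eqP => Voo; move: lower.
  by rewrite Voo gt0_muley ?lte_fin// leye_eq.
by move=> Voo; rewrite !lte_add_pinfty// ltry.
Qed.

Lemma theta_sum0_ge1 : (1 <= theta_sum 0 s)%E.
Proof. by rewrite theta_sumE -addeA leeDl// adde_ge0. Qed.

(** With t = sqrt s, the Riemann bounds divided by sqrt pi read t V <= 1/2 <= t (1 + V), while the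
    theta sum is 1 + 2 V. The estimate is used both for s tending to 0 and for s tending to
    infinity. *)
Lemma theta_sum0_bounds :
  `|Num.sqrt s * fine (theta_sum 0 s) - 1| <= Num.sqrt s.
Proof.
have Vfin : V \is a fin_num.
  rewrite ge0_fin_numE// ltNge leye_eq; apply/eqP => Voo; move: lower.
  by rewrite Voo gt0_muley ?lte_fin// leye_eq.
move: lower upper; rewrite theta_sumE -(fineK Vfin).
set v := fine V; rewrite -!EFinD -!EFinM !lee_fin/= /h sqrtrM ?pi_ge0//.
set p := Num.sqrt pi; set t := Num.sqrt s => lo up.
have p0 : 0 < p by rewrite sqrtr_gt0 pi_gt0.
have lo' : t * v <= 1 / 2.
  by rewrite -(ler_pM2l p0); lra.
have up' : 1 / 2 <= t * (1 + v).
  by rewrite -(ler_pM2l p0); lra.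
by rewrite ler_norml; apply/andP; split; lra.
Qed.

End theta3_bounds.

(** * Duplication formulas *)

(** Finite subsums give one inequality; the converse is the same inequality for [c^-1], with c = 0
    treated apart. *)
Lemma esumZl {R : realType} {I : choiceType} (c : R) (f : I -> \bar R) :
    0 <= c -> (forall i, 0 <= f i)%E ->
  (\esum_(i in [set: I]) (c%:E * f i) = c%:E * \esum_(i in [set: I]) f i)%E.
Proof.
move=> c0 f0; have leZ (d : R) (g : I -> \bar R) : 0 <= d ->
    (forall i, 0 <= g i)%E ->
    (\esum_(i in [set: I]) (d%:E * g i) <= d%:E * \esum_(i in [set: I]) g i)%E.
  move=> d0 g0; apply: ge_ereal_sup => _ [X [finX _] <-].
  rewrite -ge0_mule_fsumr//; apply: lee_wpmul2l; rewrite ?lee_fin//.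
  by apply: ereal_sup_ubound; exists X.
apply/eqP; rewrite eq_le leZ//=; have [->|cn0] := eqVneq c 0.
  by rewrite mul0e esum_ge0// => i _; rewrite mul0e.
have cV0 : 0 <= c^-1 by rewrite invr_ge0.
have := leZ c^-1 (fun i => c%:E * f i)%E cV0.
under eq_esum do rewrite muleA -EFinM mulVf// mul1e.
move=> /(_ (fun i => mule_ge0 (c0 : (0 <= c%:E)%E) (f0 i))) le1.
rewrite -[leRHS]mul1e -[1%E]/(1%:E) -(divff cn0) EFinM -muleA.
by apply: lee_wpmul2l; rewrite ?lee_fin.
Qed.

Lemma esum_pair {R : realType} {I J : choiceType} (f : I -> R) (g : J -> R) :
    (forall i, 0 <= f i) -> (forall j, 0 <= g j) ->
    (\esum_(j in [set: J]) (g j)%:E < +oo)%E ->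
  (\esum_(p in [set: I * J]) (f p.1 * g p.2)%:E =
   (\esum_(i in [set: I]) (f i)%:E) * \esum_(j in [set: J]) (g j)%:E)%E.
Proof.
move=> f0 g0 goo; rewrite -setXTT.
have -> : ([set: I] `*` [set: J]) = ([set: I] `*`` (fun=> [set: J])).
  by apply/seteqP; split.
rewrite -(esum_esum (a := fun i j => (f i * g j)%:E)); last first.
  by move=> i j _ _; rewrite lee_fin mulr_ge0.
under eq_esum do under eq_esum do rewrite EFinM.
under eq_esum do rewrite esumZl//.
(* [esumZl] pulls out a real constant, so the inner sum must first be made real. *)
have gfin : \esum_(j in [set: J]) (g j)%:E \is a fin_num.
  by rewrite ge0_fin_numE// esum_ge0// => i _; rewrite lee_fin.
rewrite -(fineK gfin) muleC -esumZl//; last first.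
  by rewrite fine_ge0// esum_ge0// => i _; rewrite lee_fin.
by apply: eq_esum => i _; rewrite muleC.
Qed.

Lemma theta_sumD1 {R : realType} (c s : R) : theta_sum (c + 1) s = theta_sum c s.
Proof.
rewrite /theta_sum [RHS](reindex_esum [set: int] _ (fun m => m + 1)).
  by apply: eq_esum => m _; rewrite intrD addrAC addrA.
split => [m|m n _ _|m _] //=; first exact: addIr.
by exists (m - 1) => //; rewrite subrK.
Qed.

(** Even m = 2k gives the square 4 k^2, odd m = 2k + 1 gives 4 (k + 1/2)^2. *)
Lemma theta_sum_parity {R : realType} (s : R) :
  theta_sum 0 s = (theta_sum 0 (4 * s) + theta_sum (1 / 2) (4 * s))%E.
Proof.
rewrite /theta_sum (esum_cover2 (e0 := fun m : int => m * 2)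
  (e1 := fun m : int => m * 2 + 1)).
- congr (_ + _)%E; apply: eq_esum => m _; rewrite /gaussian ?intrD ?intrM;
  by congr (expR _)%:E; field.
- by move=> m; rewrite lee_fin gaussian_ge0.
- by move=> m n; lia.
- by move=> m n; lia.
- by move=> m n; lia.
- move=> m; have [E|E] : (m = (m %/ 2)%Z * 2) \/ (m = (m %/ 2)%Z * 2 + 1) by lia.
    by left; exists (m %/ 2)%Z.
  by right; exists (m %/ 2)%Z.
Qed.

(** The map (u, v) -> (u + v, u - v) has as image the pairs of even sum; its translate by (1, 0)
    fills the odd coset. *)
Lemma esum_int2_rotate {R : realType} (f : int -> int -> \bar R) :
    (forall m n, 0 <= f m n)%E ->
  (\esum_(p in [set: int * int]) f p.1 p.2 =
   \esum_(p in [set: int * int]) f (p.1 + p.2)%R (p.1 - p.2)%R +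
   \esum_(p in [set: int * int]) f (p.1 + p.2 + 1)%R (p.1 - p.2)%R)%E.
Proof.
move=> f0; apply: (esum_cover2 (f := fun p : int * int => f p.1 p.2)
  (e0 := fun p : int * int => (p.1 + p.2, p.1 - p.2))
  (e1 := fun p : int * int => (p.1 + p.2 + 1, p.1 - p.2))) => //=.
- by move=> [a b] [c d] /= [E1 E2]; congr (_, _); lia.
- by move=> [a b] [c d] /= [E1 E2]; congr (_, _); lia.
- by move=> [a b] [c d] /= [E1 E2]; lia.
- move=> [m n].
  have [E|E] : ((m + n) %% 2 = 0)%Z \/ ((m + n) %% 2 = 1)%Z by lia.
    by left; exists ((m + n) %/ 2, (m - n) %/ 2)%Z => /=; congr (_, _); lia.
  right; exists ((m + n - 1) %/ 2, (m - n - 1) %/ 2)%Z => /=; congr (_, _); lia.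
Qed.

(** By parity, this sum is the odd part of the finite theta3 sum at s / 4. *)
Lemma theta_sum_half_fin {R : realType} (s : R) : 0 < s ->
  (theta_sum (1 / 2) s < +oo)%E.
Proof.
move=> s0; have s40 : 0 < s / 4 by rewrite divr_gt0.
have := theta_sum0_fin s40; rewrite theta_sum_parity.
have -> : 4 * (s / 4) = s by field.
by apply: le_lt_trans; rewrite leeDr// theta_sum_ge0.
Qed.

(* The parallelogram law: this is what makes the change of variables
   (m, n) = (u + v, u - v) yield the duplication formulas. *)
Lemma gaussian_rotate {R : realType} (s x y : R) :
  gaussian s (x + y) * gaussian s (x - y) = gaussian (2 * s) x * gaussian (2 * s) y.
Proof. by rewrite /gaussian -!expRD; congr expR; ring. Qed.

Lemma theta_sum_mul {R : realType} (c d s : R) : (theta_sum d s < +oo)%E ->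
  (theta_sum c s * theta_sum d s = \esum_(p in [set: int * int])
     (gaussian s (p.1%:~R + c) * gaussian s (p.2%:~R + d))%:E)%E.
Proof.
move=> fin; rewrite /theta_sum (esum_pair (f := fun m => gaussian s (m%:~R + c))
  (g := fun m => gaussian s (m%:~R + d)))// => m; exact: gaussian_ge0.
Qed.

(** Rotate the double sum for the square. On the even coset the new variables are u + c and v; on
    the odd one they are u + c + 1/2 and v + 1/2. *)
Lemma theta_sum_sqr {R : realType} (c s : R) : 0 < s ->
    (theta_sum c s < +oo)%E ->
  (theta_sum c s * theta_sum c s =
   theta_sum c (2 * s) * theta_sum 0 (2 * s) +
   theta_sum (c + 1 / 2) (2 * s) * theta_sum (1 / 2) (2 * s))%E.
Proof.
move=> s0 fin; have s20 : 0 < 2 * s by rewrite mulr_gt0.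
rewrite !theta_sum_mul//; [|exact: theta_sum_half_fin|exact: theta_sum0_fin].
rewrite (esum_int2_rotate (f := fun m n =>
  (gaussian s (m%:~R + c) * gaussian s (n%:~R + c))%:E)); last first.
  by move=> m n; rewrite lee_fin mulr_ge0// gaussian_ge0.
congr (_ + _)%E; apply: eq_esum => -[m n] _ /=; rewrite -gaussian_rotate;
  by rewrite !(intrD, intrN); congr (gaussian s _ * gaussian s _)%:E; field.
Qed.

(* theta_k(is) for real s > 0; theta4 is obtained by splitting its sum, and that
   of theta3, into even and odd terms. *)
Definition theta3_imag {R : realType} (s : R) : R := fine (theta_sum 0 s).
Definition theta2_imag {R : realType} (s : R) : R := fine (theta_sum (1 / 2) s).
Definition theta4_imag {R : realType} (s : R) : R :=
  theta3_imag (4 * s) - theta2_imag (4 * s).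

Section theta_imag.
Context {R : realType}.
Implicit Types s : R.
Local Notation A := theta3_imag.
Local Notation B := theta2_imag.
Local Notation D := theta4_imag.

Lemma theta3_imagK s : 0 < s -> (A s)%:E = theta_sum 0 s.
Proof.
by move=> s0; rewrite fineK// ge0_fin_numE ?theta_sum_ge0// theta_sum0_fin.
Qed.

Lemma theta2_imagK s : 0 < s -> (B s)%:E = theta_sum (1 / 2) s.
Proof.
by move=> s0; rewrite fineK// ge0_fin_numE ?theta_sum_ge0// theta_sum_half_fin.
Qed.

Lemma theta2_imag_ge0 s : 0 <= B s.
Proof. by rewrite fine_ge0 ?theta_sum_ge0. Qed.

Lemma theta3_imag_ge1 s : 0 < s -> 1 <= A s.
Proof. by move=> s0; rewrite -lee_fin theta3_imagK// theta_sum0_ge1. Qed.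

Lemma theta3_imag_parity s : 0 < s -> A s = A (4 * s) + B (4 * s).
Proof.
move=> s0; have s40 : 0 < 4 * s by rewrite mulr_gt0.
apply: EFin_inj; rewrite EFinD (theta3_imagK s0) (theta3_imagK s40).
by rewrite (theta2_imagK s40) theta_sum_parity.
Qed.

Lemma theta3_imag_sqr s : 0 < s -> A s ^+ 2 = A (2 * s) ^+ 2 + B (2 * s) ^+ 2.
Proof.
move=> s0; have s20 : 0 < 2 * s by rewrite mulr_gt0.
apply: EFin_inj; rewrite EFinD !expr2 !EFinM (theta3_imagK s0).
rewrite (theta3_imagK s20) (theta2_imagK s20).
by rewrite (theta_sum_sqr s0 (theta_sum0_fin s0)) add0r.
Qed.

Lemma theta2_imag_sqr s : 0 < s -> B s ^+ 2 = 2 * (A (2 * s) * B (2 * s)).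
Proof.
move=> s0; have s20 : 0 < 2 * s by rewrite mulr_gt0.
rewrite mulr_natl mulr2n.
apply: EFin_inj; rewrite EFinD expr2 !EFinM (theta2_imagK s0).
rewrite (theta3_imagK s20) (theta2_imagK s20).
rewrite (theta_sum_sqr s0 (theta_sum_half_fin s0)).
(* The odd coset has offset 1, equivalent to 0 by periodicity, so the two products coincide up to
   order. *)
have -> : 1 / 2 + 1 / 2 = 0 + 1 :> R by field.
by rewrite theta_sumD1; congr (_ + _)%E; rewrite muleC.
Qed.

(** In the square of A(4s) - B(4s), the squares add up to A(2s)^2 and the cross term is B(2s)^2. *)
Lemma theta4_imag_sqr s : 0 < s -> D s ^+ 2 = A (2 * s) ^+ 2 - B (2 * s) ^+ 2.
Proof.
move=> s0; have s20 : 0 < 2 * s by rewrite mulr_gt0.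
rewrite (theta3_imag_sqr s20) (theta2_imag_sqr s20) /D.
have -> : 2 * (2 * s) = 4 * s by ring.
by ring.
Qed.

(** A difference of squares at 4s: by parity its factors are A(s) and D(s). *)
Lemma theta4_imag_double s : 0 < s -> D (2 * s) ^+ 2 = A s * D s.
Proof.
move=> s0; have s20 : 0 < 2 * s by rewrite mulr_gt0.
rewrite (theta4_imag_sqr s20) (theta3_imag_parity s0) /D.
have -> : 2 * (2 * s) = 4 * s by ring.
by ring.
Qed.

(** The sign, hidden in the alternating series, follows because A(s) D(s) is a square and A(s) >
    0. *)
Lemma theta4_imag_ge0 s : 0 < s -> 0 <= D s.
Proof.
move=> s0; have : 0 <= A s * D s by rewrite -theta4_imag_double// sqr_ge0.
by rewrite pmulr_rge0// (lt_le_trans ltr01)// theta3_imag_ge1.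
Qed.

Lemma theta3_imag_double s : 0 < s -> A (2 * s) ^+ 2 = (A s ^+ 2 + D s ^+ 2) / 2.
Proof. by move=> s0; rewrite (theta4_imag_sqr s0) (theta3_imag_sqr s0); field. Qed.

(** With x = A(2s)^2 and y = B(2s)^2 this is (x + y)^2 = 4 x y + (x - y)^2. *)
Lemma jacobi_identity_imag s : 0 < s -> A s ^+ 4 = B s ^+ 4 + D s ^+ 4.
Proof.
move=> s0; rewrite !(exprM _ 2 2) (theta4_imag_sqr s0) (theta3_imag_sqr s0).
by rewrite (theta2_imag_sqr s0); ring.
Qed.

End theta_imag.

(** * The arithmetic-geometric mean *)

Section agm.
Context {R : realType}.
Implicit Types u v : nat -> R.

(** The geometric mean is given through its square; nonnegativity of [v] selects the root. *)
Definition agm_iterates u v := forall n,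
  [/\ 0 < u n, 0 <= v n, u n.+1 = (u n + v n) / 2 & v n.+1 ^+ 2 = u n * v n].

(** After one step both coordinates are strictly smaller. Both means are monotone and homogeneous,
    so a common ratio c < 1 persists to the limit. *)
Lemma agm_lt_cvg_lt u v u' v' (l l' : R) :
    agm_iterates u v -> agm_iterates u' v' -> u 0%N = u' 0%N -> v 0%N < v' 0%N ->
    u @ \oo --> l -> u' @ \oo --> l' -> 0 < l' -> l < l'.
Proof.
move=> H H' u0E v0lt ul ul' l'0.
have [u0 v0 u1E v1E] := H 0%N; have [u'0 v'0 u1E' v1E'] := H' 0%N.
have [u1 v1 _ _] := H 1%N; have [u'1 v'1 _ _] := H' 1%N.
have v'0gt : 0 < v' 0%N by exact: le_lt_trans v0lt.
have v'1gt : 0 < v' 1%N.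
  by rewrite lt_neqAle v'1 andbT eq_sym -sqrf_eq0 v1E' mulf_neq0// gt_eqF.
have ult : u 1%N < u' 1%N by rewrite u1E u1E'; lra.
have vlt : v 1%N < v' 1%N.
  by rewrite -(@ltr_pXn2r _ 2)// ?nnegrE// v1E v1E' u0E ltr_pM2l.
(* Ratios are taken at index 1, since at index 0 the first coordinates agree and their ratio is
   1. *)
pose c := Num.max (u 1%N / u' 1%N) (v 1%N / v' 1%N).
have c0 : 0 <= c by rewrite le_max !divr_ge0// ltW.
have c1 : c < 1 by rewrite gt_max !ltr_pdivrMr// !mul1r ult vlt.
have le n : u n.+1 <= c * u' n.+1 /\ v n.+1 <= c * v' n.+1.
  elim: n => [|n [IHu IHv]].
    by split; rewrite -ler_pdivrMr// le_max lexx ?orbT.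
  have [un vn uE vE] := H n.+1; have [u'n v'n uE' vE'] := H' n.+1.
  have [_ vSn _ _] := H n.+2; have [_ v'Sn _ _] := H' n.+2.
  split; first by rewrite uE uE'; lra.
  rewrite -(@ler_pXn2r _ 2)// ?nnegrE ?mulr_ge0//.
  rewrite vE exprMn vE' expr2 mulrACA ler_pM// ltW//.
have lc : l <= c * l'.
  have cl : (fun n => c * u' n) @ \oo --> c * l' by apply: cvgM => //; exact: cvg_cst.
  apply: (@ler_cvg_to nat \oo _ R u (fun n => c * u' n) l (c * l') ul cl).
  near=> n.
  have n0 : (0 < n)%N by near: n; exact: nbhs_infty_gt.
  by rewrite -(prednK n0); have [] := le n.-1.
by apply: le_lt_trans lc _; rewrite -[ltRHS]mul1r ltr_pM2r.
Unshelve. all: by end_near. Qed.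

Lemma agm_cvg_inj u v u' v' (l : R) :
    agm_iterates u v -> agm_iterates u' v' -> u 0%N = u' 0%N ->
    u @ \oo --> l -> u' @ \oo --> l -> 0 < l -> v 0%N = v' 0%N.
Proof.
move=> H H' E ul ul' l0; case: (ltgtP (v 0%N) (v' 0%N)) => // vlt.
  by have := agm_lt_cvg_lt H H' E vlt ul ul' l0; rewrite ltxx.
by have := agm_lt_cvg_lt H' H (esym E) vlt ul' ul l0; rewrite ltxx.
Qed.

End agm.

(** * Equality of theta2^2 and theta4^2 at i *)

Section theta2_theta4_at_i.
Context {R : realType}.
Local Notation A := (@theta3_imag R).
Local Notation B := (@theta2_imag R).
Local Notation D := (@theta4_imag R).
(** Its powers r^n are the square roots of 2^-n, the error terms in both limits. *)
Let r : R := Num.sqrt 2^-1.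

Let r0 : 0 < r. Proof. by rewrite sqrtr_gt0 invr_gt0. Qed.

Let r_sqr : r ^+ 2 = 2^-1. Proof. by rewrite sqr_sqrtr// invr_ge0. Qed.

Let cvg_rX : (fun n => r ^+ n) @ \oo --> 0.
Proof.
apply: cvg_expr; rewrite ger0_norm ?ltW// -(@ltr_pXn2r _ 2)// ?nnegrE ?ltW//.
by rewrite r_sqr expr1n invf_lt1// ltr1n.
Qed.

Let cvg_one : (fun=> 1) @ \oo --> (1 : R). Proof. exact: cvg_cst. Qed.

Let rXE n : (2 ^- n : R) = (r ^+ n) ^+ 2.
Proof. by rewrite -exprM mulnC exprM r_sqr exprVn. Qed.

Let theta3_bounds (s : R) : 0 < s -> `|Num.sqrt s * A s - 1| <= Num.sqrt s.
Proof. exact: theta_sum0_bounds. Qed.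

(** Dividing the bound by sqrt s at s = 2^n squeezes A(s) between 1 and 1 + r^n. *)
Let cvg_theta3_sqr : (fun n => A (2 ^+ n) ^+ 2) @ \oo --> (1 : R).
Proof.
have cA : (fun n => A (2 ^+ n)) @ \oo --> (1 : R).
  have cu : (fun n => 1 + r ^+ n) @ \oo --> (1 + 0 : R).
    exact: cvgD cvg_one cvg_rX.
  rewrite addr0 in cu; apply: (squeeze_cvgr _ cvg_one cu); apply: nearW => n /=.
  have s0 : (0 : R) < 2 ^+ n by rewrite exprn_gt0.
  rewrite theta3_imag_ge1//=; have := theta3_bounds s0.
  have -> : Num.sqrt (2 ^+ n) = r ^- n.
    have -> : (2 : R) ^+ n = (r ^- n) ^+ 2.
      by rewrite -exprVn -exprM mulnC exprM exprVn r_sqr invrK.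
    by rewrite sqrtr_sqr ger0_norm// invr_ge0 exprn_ge0// ltW.
  rewrite ler_norml => /andP[_]; rewrite lerBlDl.
  have rn : 0 < r ^+ n by rewrite exprn_gt0.
  by rewrite mulrC ler_pdivrMr// mulrDl mulVf ?gt_eqF// mul1r addrC.
have := cvgM cA cA; rewrite mulr1; exact.
Qed.

Let cvg_rescaled_theta3_sqr :
  (fun n => 2 ^- n * A (2 ^- n) ^+ 2) @ \oo --> (1 : R).
Proof.
have cA : (fun n => r ^+ n * A (2 ^- n)) @ \oo --> (1 : R).
  have cu : (fun n => 1 + r ^+ n) @ \oo --> (1 + 0 : R).
    exact: cvgD cvg_one cvg_rX.
  have cl : (fun n => 1 - r ^+ n) @ \oo --> (1 - 0 : R).
    exact: cvgB cvg_one cvg_rX.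
  rewrite addr0 in cu; rewrite subr0 in cl; apply: (squeeze_cvgr _ cl cu); apply: nearW => n /=.
  have s0 : (0 : R) < 2 ^- n by rewrite invr_gt0 exprn_gt0.
  have := theta3_bounds s0.
  have -> : Num.sqrt (2 ^- n) = r ^+ n.
    by rewrite rXE sqrtr_sqr ger0_norm// exprn_ge0// ltW.
  by rewrite ler_norml => /andP[? ?]; apply/andP; split; lra.
have -> : (fun n => 2 ^- n * A (2 ^- n) ^+ 2) =
    (fun n => (r ^+ n * A (2 ^- n)) * (r ^+ n * A (2 ^- n))).
  by apply/funext => n; rewrite rXE; ring.
by have := cvgM cA cA; rewrite mulr1; exact.
Qed.

Lemma theta2_sqr_eq_theta4_sqr_at_i : B 1 ^+ 2 = D 1 ^+ 2.
Proof.
have A0 s : 0 < s -> 0 < A s.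
  by move=> s0; rewrite (lt_le_trans ltr01)// theta3_imag_ge1.
have := @agm_cvg_inj R (fun n => 2 ^- n * A (2 ^- n) ^+ 2)
  (fun n => 2 ^- n * B (2 ^- n) ^+ 2) (fun n => A (2 ^+ n) ^+ 2)
  (fun n => D (2 ^+ n) ^+ 2) 1.
rewrite /= !expr0 invr1 !mul1r; apply=> //.
(* Halving s turns A^2 and B^2 into A^2 + B^2 and 2 A B; the weight 2^-n makes these the arithmetic
   and geometric means. *)
- move=> n; have s0 : (0 : R) < 2 ^- n by rewrite invr_gt0 exprn_gt0.
  have sS0 : (0 : R) < 2 ^- n.+1 by rewrite invr_gt0 exprn_gt0.
  have sE : 2 * 2 ^- n.+1 = 2 ^- n :> R.
    by rewrite exprS invfM mulrA mulfV// mul1r.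
  have sE' : 2 ^- n.+1 = 2 ^- n / 2 :> R by rewrite -sE; field.
  split.
  - by rewrite mulr_gt0// exprn_gt0// A0.
  - by rewrite mulr_ge0 ?sqr_ge0// ltW.
  - by rewrite (theta3_imag_sqr sS0) sE sE'; field.
  - by rewrite (theta2_imag_sqr sS0) sE sE'; field.
- move=> n; have s0 : (0 : R) < 2 ^+ n by rewrite exprn_gt0.
  rewrite [2 ^+ n.+1]exprS; split.
  - by rewrite exprn_gt0// A0.
  - exact: sqr_ge0.
  - exact: theta3_imag_double.
  - by rewrite (theta4_imag_double s0); ring.
Qed.

(** As B(1)^4 = D(1)^4, the Jacobi identity gives A(1)^4 = 2 D(1)^4. *)
Lemma theta2_theta4_at_i : B 1 ^+ 4 * D 1 ^+ 4 = A 1 ^+ 8 / 4.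
Proof.
have := jacobi_identity_imag (@ltr01 R).
rewrite (exprM (A 1) 4 2) => ->; rewrite !(exprM _ 2 2).
by rewrite theta2_sqr_eq_theta4_sqr_at_i; field.
Qed.

End theta2_theta4_at_i.

(** * Unimodular lattices and theta values on the imaginary axis *)

Lemma dotprod_mulmx {R : realType} (n : nat) (x y : 'rV[R]_n) :
  dotprod x y = (x *m y^T) 0 0.
Proof. by rewrite mxE; apply: eq_bigr => i _; rewrite mxE. Qed.

Lemma sub_lattice_of {R : realType} (n : nat) (B : 'M[R]_n) i :
  lattice_of B (row i B).
Proof.
exists (delta_mx 0 i) => //; rewrite rowE; congr (_ *m _).
by apply/matrixP => j k; rewrite !mxE; case: (_ && _).
Qed.

(** The square is the Gram determinant of the rows, whose entries are inner products of vectors of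
    L. *)
Lemma det_sqr_int {R : realType} (n : nat) (L : set 'rV[R]_n) (X : 'M[R]_n) :
  L `<=` dual_lattice L -> (forall i, L (row i X)) -> \det X ^+ 2 \is a Num.int.
Proof.
move=> Ldual XL; rewrite expr2 -{2}det_tr -det_mulmx.
have entry i j : (X *m X^T) i j \is a Num.int.
  have <- : dotprod (row i X) (row j X) = (X *m X^T) i j.
    by rewrite mxE; apply: eq_bigr => k _; rewrite !mxE.
  exact: Ldual.
by apply: rpred_sum => s _; rewrite rpredMsign; apply: rpred_prod => i _.
Qed.

(** The rows of the inverse transpose C form the dual basis and lie in L by self-duality. So (det
    B)^2 and its inverse are both nonzero integers. *)
Lemma unimodular_det {R : realType} (n : nat) (L : set 'rV[R]_n) (B : 'M[R]_n) :
  unimodular L -> is_basis_of L B -> `|\det B| = 1.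
Proof.
move=> [_ Ldual] [Bunit LB]; set C := (invmx B)^T.
have Bint : \det B ^+ 2 \is a Num.int.
  by apply: (@det_sqr_int _ _ L); [rewrite {1}Ldual|rewrite LB => i; exact: sub_lattice_of].
have Cint : \det C ^+ 2 \is a Num.int.
  apply: (@det_sqr_int _ _ L); first by rewrite {1}Ldual.
  move=> i; rewrite Ldual => l; rewrite LB => -[z _ <-].
  rewrite dotprod_mulmx trmx_mul mulmxA -row_mul /C -trmx_mul mulmxV// trmx1.
  by rewrite row1 -rowE !mxE intr_int.
have dB0 : \det B != 0 by rewrite -unitfE -unitmxE.
have dC0 : \det C != 0 by rewrite det_tr det_inv invr_eq0.
have := norm_intr_ge1 Cint; have := norm_intr_ge1 Bint.
rewrite !sqrf_eq0 !normrX => /(_ dB0) B1 /(_ dC0).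
rewrite det_tr det_inv normfV exprVn invf_ge1 ?exprn_gt0 ?normr_gt0// => B1'.
apply/eqP; rewrite -(@eqrXn2 _ 2)// expr1n.
by apply/eqP/le_anti; rewrite B1 B1'.
Qed.

Lemma unimodular_volume {R : realType} (n : nat) (L : set 'rV[R]_n) :
  unimodular L -> lattice_volume L = 1.
Proof.
move=> Luni; apply: (unimodular_det Luni).
by case: Luni => -[B LB] _; exact: (xgetI 0 LB).
Qed.

Lemma qpow_imag {R : realType} (y x : R) :
  qpow (0 +i* y) x = (expR (- (pi * y * x)))%:C.
Proof.
rewrite /qpow -complexiE; set z := _ * _.
have -> : z = (- (pi * y * x))%:C.
  rewrite /z; apply/eqP; rewrite eq_complex /=; apply/andP; split; apply/eqP; ring.
by rewrite /cexp /= cos0 sin0 mulr1.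
Qed.

Lemma theta3_imagE {R : realType} (s : R) : 0 < s ->
  theta3 (0 +i* s) = (theta3_imag s)%:C.
Proof.
move=> s0; rewrite /theta3 /theta3_imag -csum_esum.
- by congr csum; apply/funext => m; rewrite qpow_imag /gaussian addr0.
- by move=> m; exact: gaussian_ge0.
- exact: theta_sum0_fin.
Qed.

Lemma theta2_imagE {R : realType} (s : R) : 0 < s ->
  theta2 (0 +i* s) = (theta2_imag s)%:C.
Proof.
move=> s0; rewrite /theta2 /theta2_imag -csum_esum.
- by congr csum; apply/funext => m; rewrite qpow_imag.
- by move=> m; exact: gaussian_ge0.
- exact: theta_sum_half_fin.
Qed.

Lemma theta4_imagE {R : realType} (s : R) : 0 < s ->
  theta4 (0 +i* s) = (theta4_imag s)%:C.
Proof.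
move=> s0; have s40 : 0 < 4 * s by rewrite mulr_gt0.
(* The sign of the m-th term depends on the parity of m, so the theta4 family is [g false - g true];
   each part is a theta sum at 4s. *)
pose g (b : bool) (m : int) : R := if odd `|m|%N == b then gaussian s m%:~R else 0.
have g0 b m : 0 <= g b m by rewrite /g; case: ifP => // _; exact: gaussian_ge0.
have gE b : (\esum_(m in [set: int]) (g b m)%:E =
    theta_sum ((if b then 1 / 2 else 0) : R)%R (4 * s)%R)%E.
  rewrite (esum_cover2 (e0 := fun m : int => m * 2) (e1 := fun m : int => m * 2 + 1)).
  - case: b g0 => g0.
      rewrite esum1 ?add0e.
        apply: eq_esum => m _; rewrite /g ifT; last by lia.
        by rewrite /gaussian intrD intrM; congr (expR _)%:E; field.
      by move=> m _; rewrite /g ifF//; lia.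
    rewrite [X in (_ + X)%E]esum1 ?adde0.
      apply: eq_esum => m _; rewrite /g ifT; last by lia.
      by rewrite /gaussian intrM; congr (expR _)%:E; field.
    by move=> m _; rewrite /g ifF//; lia.
  - by move=> m; rewrite lee_fin.
  - by move=> m n; lia.
  - by move=> m n; lia.
  - by move=> m n; lia.
  - move=> m; have [E|E] : (m = (m %/ 2)%Z * 2) \/ (m = (m %/ 2)%Z * 2 + 1) by lia.
      by left; exists (m %/ 2)%Z.
    by right; exists (m %/ 2)%Z.
rewrite /theta4_imag /theta3_imag /theta2_imag -(gE false) -(gE true) -csumB_esum//.
- congr csum; apply/funext => m; rewrite qpow_imag mulr1.
  rewrite -rmorphN -rmorphXn/=; congr (_%:C).
  rewrite exprNn -signr_odd oddX /=.
  have -> : expR (- (pi * s)) ^+ (`|m| ^ 2) = gaussian s m%:~R.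
    rewrite -expRM_natl /gaussian; congr expR.
    by rewrite mulrN mulrC natrX natr_absz intr_norm real_normK ?num_real.
  by rewrite /g; case: (odd _) => /=; rewrite ?expr1 ?expr0 ?mulN1r ?mul1r ?sub0r ?subr0.
- by rewrite gE theta_sum0_fin.
- by rewrite gE theta_sum_half_fin.
Qed.

(** The constant 2^6 is the 16 of [Delta8] times the 4 of [theta2_theta4_at_i]. *)
Lemma Delta8_at_i {R : realType} :
  Delta8 (0 +i* 1) = (theta3_imag 1 ^+ 8 / 2 ^+ 6)%:C :> R[i].
Proof.
rewrite /Delta8 theta2_imagE// theta4_imagE// -mulrA -!rmorphXn/= -rmorphM/=.
rewrite theta2_theta4_at_i.
have -> : 1 / 16 = (1 / 16 : R)%:C by rewrite rmorphM fmorphV rmorph1 rmorph_nat.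
by rewrite -rmorphM/=; congr (_%:C); field.
Qed.

(** Induction on n, splitting off the first coordinate; the empty row contributes the empty product
    1. *)
Lemma esum_rV_prod {R : realType} (f : int -> R) (n : nat) :
    (forall m, 0 <= f m) -> (\esum_(m in [set: int]) (f m)%:E < +oo)%E ->
  \esum_(z in [set: 'rV[int]_n]) (\prod_(i < n) f (z 0 i))%:E =
  (fine (\esum_(m in [set: int]) (f m)%:E) ^+ n)%:E.
Proof.
move=> f0 foo; have fin : \esum_(m in [set: int]) (f m)%:E \is a fin_num.
  by rewrite ge0_fin_numE// esum_ge0// => m _; rewrite lee_fin.
elim: n => [|n IHn].
  have -> : [set: 'rV[int]_0] = [set 0].
    by apply/seteqP; split => // z _ /=; apply/rowP => -[].
  by rewrite esum_set1 big_ord0 ?lee_fin.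
pose e (p : int * 'rV[int]_n) : 'rV[int]_n.+1 :=
  \row_j if unlift ord0 j is Some i then p.2 0 i else p.1.
rewrite (reindex_esum [set: int * 'rV[int]_n] _ e); last first.
  split => //.
  - move=> [m z] [m' z'] _ _ /rowP E; congr (_, _).
      by have := E ord0; rewrite !mxE unlift_none.
    by apply/rowP => i; have := E (lift ord0 i); rewrite !mxE liftK.
  - move=> w _; exists (w 0 ord0, \row_i w 0 (lift ord0 i)) => //.
    by apply/rowP => j; rewrite !mxE; case: unliftP => [i ->|->]; rewrite ?mxE.
transitivity (\esum_(p in [set: int * 'rV[int]_n])
    (f p.1 * \prod_(i < n) f (p.2 0 i))%:E).
  apply: eq_esum => p _; rewrite big_ord_recl !mxE unlift_none.
  by congr (_ * _)%:E; apply: eq_bigr => i _; rewrite !mxE liftK.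
rewrite (esum_pair (g := fun z : 'rV[int]_n => \prod_(i < n) f (z 0 i)))//.
- by rewrite IHn exprS EFinM fineK.
- by move=> z; apply: prodr_ge0.
- by rewrite IHn ltry.
Qed.

Lemma theta_series_Zn {R : realType} (n : nat) (s : R) : 0 < s ->
  theta_series (lattice_of (1%:M : 'M[R]_n)) (0 +i* s) =
  (theta3_imag s ^+ n)%:C.
Proof.
move=> s0; pose L := lattice_of (1%:M : 'M[R]_n).
pose f (l : L) := expR (- (pi * s * dotprod (val l) (val l))).
have Lz (z : 'rV[int]_n) : map_mx intr z \in L.
  by rewrite inE; exists z => //; rewrite mulmx1.
pose e (z : 'rV[int]_n) : L := SigSub (Lz z).
have esumE : \esum_(l in [set: L]) (f l)%:E = (theta3_imag s ^+ n)%:E.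
  rewrite (reindex_esum [set: 'rV[int]_n] _ e); last first.
    split => //.
    - move=> z z' _ _ /(congr1 val) /= /rowP E; apply/rowP => i.
      by have := E i; rewrite !mxE => /intr_inj.
    - move=> [l Ll] _; have := Ll; rewrite inE => -[z _ zl].
      by exists z => //; apply: val_inj => /=; rewrite -zl mulmx1.
  have := esum_rV_prod n (fun m => gaussian_ge0 s (m%:~R + 0)) (theta_sum0_fin s0).
  rewrite -/(theta_sum 0 s) -/(theta3_imag s) => <-.
  apply: eq_esum => z _; rewrite /f /= /dotprod mulr_sumr -sumrN expR_sum.
  by congr (_%:E); apply: eq_bigr => i _; rewrite !mxE addr0 /gaussian expr2.
rewrite /theta_series -[theta3_imag s ^+ n]/(fine (theta3_imag s ^+ n)%:E) -esumE.
rewrite -csum_esum; first by congr csum; apply/funext => l; rewrite qpow_imag.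
- by move=> l; exact: expR_ge0.
- by rewrite esumE ltry.
Qed.

Theorem mainTheorem1 (R : realType) (n : nat) (L : set 'rV[R]_n)
    (a : 'I_(n %/ 8).+1 -> int)
    (hL : unimodular L)
    (ha : forall t : R[i], upper_half_plane t ->
       theta_series L t =
       \sum_(r < (n %/ 8).+1)
         (a r)%:~R * theta3 t ^+ (n - 8 * r)%N * Delta8 t ^+ r)
    (hmax : secrecy_max_at L 1) :
  is_secrecy_gain L
    (1 / \sum_(r < (n %/ 8).+1) (a r)%:~R * (1 / 2 ^+ 6) ^+ r).
Proof.
exists 1; split => //.
(* The volume is 1, so v = 1 for every n, including n = 0, where [n%:R^-1] is 0. *)
rewrite /secrecy_function unimodular_volume// powR1 theta_series_Zn//.
rewrite ha ?/upper_half_plane//= Delta8_at_i theta3_imagE//.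
set A := theta3_imag 1; have A0 : A != 0.
  by rewrite gt_eqF// (lt_le_trans ltr01)// theta3_imag_ge1.
have -> : \sum_(r < (n %/ 8).+1)
    (a r)%:~R * A%:C ^+ (n - 8 * r) * (A ^+ 8 / 2 ^+ 6)%:C ^+ r =
    (A ^+ n * \sum_(r < (n %/ 8).+1) (a r)%:~R * (1 / 2 ^+ 6) ^+ r)%:C.
  rewrite mulr_sumr rmorph_sum; apply: eq_bigr => r _ /=.
  rewrite -(rmorph_int (real_complex R)) -!rmorphXn -!rmorphM/=; congr (_%:C).
  (* The range of r gives 8 r <= n, so the natural subtraction does not truncate. *)
  have -> : A ^+ n = A ^+ (n - 8 * r) * (A ^+ 8) ^+ r.
    by rewrite -exprM -exprD subnK// mulnC -leq_divRL// -ltnS.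
  rewrite mul1r exprMn; set x := _^-1 ^+ r; set y := _ ^+ 8 ^+ r.
  by ring.
rewrite -fmorph_div/=; congr (_%:C); set S := \sum_(r < _) _.
(* Only A^n is cancelled; the inverse of S is carried along, with the convention that 0 has inverse
   0. *)
by rewrite invfM mulrA mulfV ?expf_neq0.
Qed.
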